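(* For a fuzzy Riesz space $(E,\mu)$ the following are equivalent: (1) $E$ has the fuzzy $\sigma$-order continuity property; (2) every fuzzy lattice homomorphism from $E$ into a fuzzy Archimedean Riesz space is fuzzy $\sigma$-order continuous; (3) every uniformly fuzzy closed fuzzy ideal of $E$ is a fuzzy $\sigma$-ideal.
   Context: A fuzzy order on a real vector space $E$ is a map $\mu:E\times E\to[0,1]$ with $\mu(x,x)=1$; $\mu(x,y)+\mu(y,x)>1$ implies $x=y$; and $\mu(x,z)\ge\sup_{y}\min(\mu(x,y),\mu(y,z))$. Write $x\le y$ for $\mu(x,y)>\frac12$; upper bounds, suprema and infima are taken with respect to this relation. $(E,\mu)$ is a fuzzy ordered linear space if $\mu(x_1,x_2)>\frac12$ implies $\mu(x_1,x_2)\le\mu(x_1+x,x_2+x)$ for all $x$ and $\mu(x_1,x_2)\le\mu(\alpha x_1,\alpha x_2)$ for all $\alpha>0$; it is a fuzzy Riesz space if $x\vee y=\sup\{x,y\}$, $x\wedge y=\inf\{x,y\}$ exist for all $x,y$. $E^+=\{x:0\le x\}$, $|x|=x\vee(-x)$. A fuzzy Riesz space is fuzzy Archimedean if for every nonzero $x\in E^+$ the set $\{\lambda x:\lambda>0\}$ is not bounded above. A fuzzy lattice homomorphism is a linear map $T$ with $T(x\vee y)=Tx\vee Ty$; a linear map is fuzzy positive if $0\le x$ implies $0\le Tx$. A sequence $x_n$ fuzzy order converges to $x$ if there is a sequence $y_n$ decreasing with infimum $0$ and $\mu(|x_n-x|,y_n)>\frac12$ for all $n$; $T$ is fuzzy $\sigma$-order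 continuous if $x_n\to0$ in fuzzy order implies $Tx_n\to0$ in fuzzy order. $E$ has the fuzzy $\sigma$-order continuity property if every fuzzy positive operator from $E$ into any fuzzy Archimedean fuzzy Riesz space is fuzzy $\sigma$-order continuous. A fuzzy ideal is a vector subspace $A$ such that $\mu(|x|,|y|)>\frac12$ and $y\in A$ imply $x\in A$; it is a fuzzy $\sigma$-ideal if $x_n\in A\cap E^+$, $x_n\uparrow x$ (increasing with supremum $x$) imply $x\in A$. A sequence converges relatively uniformly in fuzzy order to $x$ if there is $w\in E^+$ such that for each $\varepsilon>0$ there is $n(\varepsilon)$ with $\mu(|x-x_n|,\varepsilon w)>\frac12$ for $n>n(\varepsilon)$; a set is uniformly fuzzy closed if it contains all such limits of its sequences. *)

(* Defs.v *)
From HB Require Import structures.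
From mathcomp Require Import all_boot all_order all_algebra.
From mathcomp Require Import reals.
Set Implicit Arguments. Unset Strict Implicit. Unset Printing Implicit Defensive.
Import Order.TTheory GRing.Theory Num.Theory.
Local Open Scope ring_scope.

Section Fuzzy.
Variable R : realType.

Section Space.
Variable E : lmodType R.
Variable mu : E -> E -> R.

Definition fuzzy_order : Prop :=
  (forall x y, 0 <= mu x y <= 1) /\
  (forall x, mu x x = 1) /\
  (forall x y, 1 < mu x y + mu y x -> x = y) /\
  (forall x y z, Num.min (mu x y) (mu y z) <= mu x z).

Definition fle (x y : E) : Prop := 2^-1 < mu x y.

Definition is_upper (A : E -> Prop) (u : E) : Prop := forall a, A a -> fle a u.
Definition is_lower (A : E -> Prop) (l : E) : Prop := forall a, A a -> fle l a.
Definition is_sup (A : E -> Prop) (s : E) : Prop :=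
  is_upper A s /\ forall u, is_upper A u -> fle s u.
Definition is_inf (A : E -> Prop) (s : E) : Prop :=
  is_lower A s /\ forall l, is_lower A l -> fle l s.

Definition fuzzy_ordered_linear_space : Prop :=
  fuzzy_order /\
  (forall x1 x2 x, fle x1 x2 -> mu x1 x2 <= mu (x1 + x) (x2 + x)) /\
  (forall x1 x2 (a : R), fle x1 x2 -> 0 < a -> mu x1 x2 <= mu (a *: x1) (a *: x2)).

Definition pair_set (x y : E) : E -> Prop := fun z => z = x \/ z = y.

Definition fuzzy_riesz : Prop :=
  fuzzy_ordered_linear_space /\
  forall x y, (exists s, is_sup (pair_set x y) s) /\ (exists i, is_inf (pair_set x y) i).

Definition is_join (x y a : E) : Prop := is_sup (pair_set x y) a.
Definition is_abs (x a : E) : Prop := is_join x (- x) a.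

Definition fpositive (x : E) : Prop := fle 0 x.

Definition fuzzy_archimedean : Prop :=
  forall x, fpositive x -> x != 0 ->
    ~ (exists u, forall lam : R, 0 < lam -> fle (lam *: x) u).

Definition range_set (y : nat -> E) : E -> Prop := fun z => exists n, z = y n.

Definition decr_to_0 (y : nat -> E) : Prop :=
  (forall n, fle (y n.+1) (y n)) /\ is_inf (range_set y) 0.

Definition fo_conv (x : nat -> E) (l : E) : Prop :=
  exists y : nat -> E, decr_to_0 y /\
    forall n, exists a, is_abs (x n - l) a /\ fle a (y n).

Definition incr_to (x : nat -> E) (l : E) : Prop :=
  (forall n, fle (x n) (x n.+1)) /\ is_sup (range_set x) l.

Definition subspace (A : E -> Prop) : Prop :=
  A 0 /\ (forall x y, A x -> A y -> A (x + y)) /\ (forall (a : R) x, A x -> A (a *: x)).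

Definition fuzzy_ideal (A : E -> Prop) : Prop :=
  subspace A /\
  forall x y a b, is_abs x a -> is_abs y b -> fle a b -> A y -> A x.

Definition fuzzy_sigma_ideal (A : E -> Prop) : Prop :=
  fuzzy_ideal A /\
  forall (x : nat -> E) l, (forall n, A (x n) /\ fpositive (x n)) -> incr_to x l -> A l.

Definition ru_conv (x : nat -> E) (l : E) : Prop :=
  exists w, fpositive w /\
    forall eps : R, 0 < eps -> exists N : nat, forall n, (N < n)%N ->
      exists a, is_abs (l - x n) a /\ fle a (eps *: w).

Definition uniformly_fuzzy_closed (A : E -> Prop) : Prop :=
  forall (x : nat -> E) l, (forall n, A (x n)) -> ru_conv x l -> A l.

End Space.

Section Maps.
Variables (E F : lmodType R) (mu : E -> E -> R) (nu : F -> F -> R).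

Definition fuzzy_positive_op (T : {linear E -> F}) : Prop :=
  forall x, fle mu 0 x -> fle nu 0 (T x).

Definition fuzzy_lattice_hom (T : {linear E -> F}) : Prop :=
  forall x y s, is_join mu x y s -> is_join nu (T x) (T y) (T s).

Definition fuzzy_sigma_order_cont (T : {linear E -> F}) : Prop :=
  forall x : nat -> E, fo_conv mu x 0 -> fo_conv nu (fun n => T (x n)) 0.

End Maps.

Definition sigma_order_continuity_property (E : lmodType R) (mu : E -> E -> R) : Prop :=
  forall (F : lmodType R) (nu : F -> F -> R),
    fuzzy_riesz nu -> fuzzy_archimedean nu ->
    forall T : {linear E -> F}, fuzzy_positive_op mu nu T -> fuzzy_sigma_order_cont mu nu T.

End Fuzzy.

(* Main.v *)
(** The step from (3) to (1) avoids the Dedekind completion of the target.  Let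
    [T : E -> F] be positive, [y n] decreasing to [0], [z <= T (y n)] for all
    [n], and [e > 0].  Let [D] be the cone of the [a >= 0] disjoint from some
    [(y n - e *: y 0)^+], and [J] the set of the [x] such that
    [inf {T (|x| - a) | a in D, 0 <= a <= |x|} = 0].  As [F] is Archimedean,
    [J] is a uniformly closed ideal; it contains every [(e *: y 0 - y n)^+],
    and these increase to [e *: y 0], so [y 0] lies in [J].  If [a <= y 0] is
    disjoint from [(y n - e *: y 0)^+], then [y n <= e *: y 0 + (y 0 - a)], so
    [z - e *: T (y 0) <= T (y 0 - a)].  Hence [z <= e *: T (y 0)] for every
    [e > 0], and [z <= 0].

    For (2) to (3), the quotient of [E] by a uniformly closed ideal [A] is
    Archimedean: if [n *: x <= u] modulo [A] for all [n], then
    [(x - n^-1 *: u)^+] lies in [A] and converges uniformly to [x].  An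
    increasing sequence of [A] is killed by the quotient map, hence so is its
    supremum, by continuity. *)
Require Import Defs.
From HB Require Import structures.
From mathcomp Require Import all_boot all_order all_algebra.
From mathcomp Require Import generic_quotient ring_quotient boolp classical_sets reals.
Set Implicit Arguments. Unset Strict Implicit. Unset Printing Implicit Defensive.
Import Order.TTheory GRing.Theory Num.Theory.
Local Open Scope ring_scope.
Local Open Scope quotient_scope.

(** * The vector order of a fuzzy ordered linear space *)

Section VectorOrder.
Variables (R : realType) (E : lmodType R) (mu : E -> E -> R).
Hypothesis muV : fuzzy_ordered_linear_space mu.

Lemma fle_refl x : fle mu x x.
Proof. by case: muV => -[_ [mu1 _]] _; rewrite /fle mu1 invf_lt1 // ltr1n. Qed.

Lemma fle_anti x y : fle mu x y -> fle mu y x -> x = y.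
Proof.
case: muV => -[_ [_ [anti _]]] _ xy yx; apply: anti.
by rewrite [ltLHS]splitr ltrD // div1r.
Qed.

Lemma fle_trans y x z : fle mu x y -> fle mu y z -> fle mu x z.
Proof.
case: muV => -[_ [_ [_ tr]]] _ xy yz.
by apply: lt_le_trans (tr x y z); rewrite lt_min xy.
Qed.

Lemma fle_add2r z x y : fle mu x y -> fle mu (x + z) (y + z).
Proof. by case: muV => _ [tr _] xy; apply: lt_le_trans (tr _ _ _ xy). Qed.

(** The order depends only on differences, so moving terms across an inequality reduces to an
    identity in the additive group. *)
Lemma fle_diff a b c d : fle mu a b -> d - c = b - a -> fle mu c d.
Proof.
move=> /(fle_add2r (c - a)) ab dc.
by move: ab; rewrite addrC subrK addrCA -dc addrCA subrr addr0.
Qed.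

Lemma fle_sub0 x y : fle mu 0 (y - x) <-> fle mu x y.
Proof. by split=> h; apply: (fle_diff h); rewrite subr0. Qed.

Lemma fleD a b c d : fle mu a b -> fle mu c d -> fle mu (a + c) (b + d).
Proof.
move=> ab cd; apply: (fle_trans (fle_add2r c ab)).
by rewrite ![b + _]addrC; apply: fle_add2r.
Qed.

Lemma fle_addr x y : fle mu 0 y -> fle mu x (x + y).
Proof. by move=> y0; rewrite -{1}[x]addr0; apply: fleD => //; apply: fle_refl. Qed.

Lemma fle_subr x y : fle mu 0 y -> fle mu (x - y) x.
Proof. by move=> y0; apply: (fle_diff y0); rewrite subr0 opprB addrCA subrr addr0. Qed.

Lemma fle_opp x y : fle mu x y -> fle mu (- y) (- x).
Proof. by move=> xy; apply: (fle_diff xy); rewrite opprK addrC. Qed.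

Lemma fle_subLR x y z : fle mu (x - y) z <-> fle mu x (z + y).
Proof.
by split=> h; apply: (fle_diff h); rewrite opprB addrA [z + y - x]addrAC // addrAC.
Qed.

Lemma fle_scale (c : R) x y : 0 <= c -> fle mu x y -> fle mu (c *: x) (c *: y).
Proof.
rewrite le_eqVlt => /orP[/eqP <- _|c0 xy].
  by rewrite !scale0r; apply: fle_refl.
by case: muV => _ [_ tr]; apply: lt_le_trans (tr _ _ _ xy c0).
Qed.

Lemma fle_scale0 (c : R) x : 0 <= c -> fle mu 0 x -> fle mu 0 (c *: x).
Proof. by move=> c0 /(fle_scale c0); rewrite scaler0. Qed.

Lemma fle_scaleW (c d : R) x :
  c <= d -> fle mu 0 x -> fle mu (c *: x) (d *: x).
Proof.
move=> cd x0; apply/fle_sub0; rewrite -scalerBl.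
by apply: fle_scale0; rewrite // subr_ge0.
Qed.

Lemma fle_le0 (x : E) : fle mu 0 x -> fle mu (- x) 0.
Proof. by move/fle_opp; rewrite oppr0. Qed.

Lemma is_joinP x y s : is_join mu x y s <->
  [/\ fle mu x s, fle mu y s & forall u, fle mu x u -> fle mu y u -> fle mu s u].
Proof.
split=> [[ub lub]|[xs ys lub]].
  split; [by apply: ub; left|by apply: ub; right|move=> u xu yu].
  by apply: lub => z [->|->].
split=> [z [->|->] //|u ub].
by apply: lub; apply: ub; [left|right].
Qed.

Lemma is_join_uniq x y s t : is_join mu x y s -> is_join mu x y t -> s = t.
Proof.
by move=> [us ls] [ut lt]; apply: fle_anti; [apply: ls|apply: lt].
Qed.

Lemma is_abs_id x : fle mu 0 x -> is_abs mu x x.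
Proof.
move=> x0; apply/is_joinP; split=> [||u //]; first exact: fle_refl.
by apply: (fle_trans _ x0); apply: fle_le0.
Qed.

Lemma decr_le (y : nat -> E) : (forall n, fle mu (y n.+1) (y n)) ->
  forall m n, (m <= n)%N -> fle mu (y n) (y m).
Proof.
move=> dy m; elim=> [|n IH]; first by rewrite leqn0 => /eqP->; apply: fle_refl.
rewrite leq_eqVlt ltnS => /orP[/eqP->|/IH]; first exact: fle_refl.
exact/fle_trans.
Qed.

Lemma decr_to_0P (y : nat -> E) : decr_to_0 mu y <->
  [/\ forall n, fle mu (y n.+1) (y n), forall n, fle mu 0 (y n)
    & forall l, (forall n, fle mu l (y n)) -> fle mu l 0].
Proof.
split=> [[dy [lb glb]]|[dy lb glb]].
  split=> // [n|l ll]; first by apply: lb; exists n.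
  by apply: glb => _ [n ->].
split=> //; split=> [_ [n ->] //|l ll].
by apply: glb => n; apply: ll; exists n.
Qed.

End VectorOrder.

(** * Joins, positive parts and disjointness in a fuzzy Riesz space *)

Section Riesz.
Variables (R : realType) (E : lmodType R) (mu : E -> E -> R).
Hypothesis muR : fuzzy_riesz mu.
Let muV : fuzzy_ordered_linear_space mu := proj1 muR.
Local Notation "x <<= y" := (fle mu x y) (at level 70).

(** Choice turns the join into a function; the default [0] is never taken, since joins exist in a
    fuzzy Riesz space. *)
Definition fjoin x y : E := xget 0 (is_join mu x y).
Definition fpos x : E := fjoin x 0.
Definition fabs x : E := fjoin x (- x).

Lemma fjoinP x y : is_join mu x y (fjoin x y).
Proof. by have [[s js] _] := muR.2 x y; exact: (xgetI 0 js). Qed.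

Lemma fabsE x a : is_abs mu x a -> a = fabs x.
Proof. by move=> /(is_join_uniq muV); apply; apply: fjoinP. Qed.

Lemma fle_joinl x y : x <<= fjoin x y.
Proof. by have /is_joinP[] := fjoinP x y. Qed.

Lemma fle_joinr x y : y <<= fjoin x y.
Proof. by have /is_joinP[] := fjoinP x y. Qed.

Lemma fjoin_le x y u : x <<= u -> y <<= u -> fjoin x y <<= u.
Proof. by have /is_joinP[_ _] := fjoinP x y; apply. Qed.

Lemma fle_fabs x : x <<= fabs x. Proof. exact: fle_joinl. Qed.

Lemma fleN_fabs x : - x <<= fabs x. Proof. exact: fle_joinr. Qed.

Lemma fabs_le x u : x <<= u -> - x <<= u -> fabs x <<= u.
Proof. exact: fjoin_le. Qed.

(** Adding [x <<= fabs x] and [- x <<= fabs x] gives [0 <<= 2 *: fabs x], which is then halved. *)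
Lemma fabs_ge0 x : 0 <<= fabs x.
Proof.
have := fleD muV (fle_fabs x) (fleN_fabs x).
rewrite subrr => /(fle_scale0 muV (_ : 0 <= 2^-1)).
by rewrite -mulr2n -scaler_nat scalerA mulVf ?pnatr_eq0// scale1r; apply; rewrite invr_ge0 ler0n.
Qed.

Lemma fabs_id x : 0 <<= x -> fabs x = x.
Proof. by move=> /(is_abs_id muV) /fabsE. Qed.

Lemma fabsD_le x y : fabs (x + y) <<= fabs x + fabs y.
Proof.
apply: fabs_le; first by apply: fleD => //; apply: fle_fabs.
by rewrite opprD; apply: fleD => //; apply: fleN_fabs.
Qed.

Lemma fabsZ_le (c : R) x : fabs (c *: x) <<= `|c| *: fabs x.
Proof.
have le_scale (d : R) : d *: x <<= `|d| *: fabs x.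
  case: (ger0P d) => d0; first by apply: fle_scale => //; apply: fle_fabs.
  rewrite -[d in d *: _]opprK scaleNr -scalerN.
  by apply: fle_scale => //; [rewrite oppr_ge0 ltW|apply: fleN_fabs].
by apply: fabs_le; [|rewrite -scaleNr -normrN]; apply: le_scale.
Qed.

Lemma fpos_ge0 x : 0 <<= fpos x. Proof. exact: fle_joinr. Qed.

Lemma fle_fpos x : x <<= fpos x. Proof. exact: fle_joinl. Qed.

Lemma fpos_le x u : x <<= u -> 0 <<= u -> fpos x <<= u.
Proof. exact: fjoin_le. Qed.

Lemma fpos_mono x y : x <<= y -> fpos x <<= fpos y.
Proof.
move=> xy; apply: fpos_le; last exact: fpos_ge0.
exact: fle_trans xy (fle_fpos _).
Qed.

Lemma fpos_fposN x : fpos x = x + fpos (- x).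
Proof.
apply: (fle_anti muV).
  apply: fpos_le; first by apply: fle_addr => //; apply: fpos_ge0.
  by rewrite -(subrr x) ![x + _]addrC; apply: fle_add2r => //; apply: fle_fpos.
have h : fpos (- x) <<= fpos x - x.
  apply: fpos_le; last by apply/fle_sub0 => //; apply: fle_fpos.
  by rewrite -{1}[- x]add0r; apply: fle_add2r => //; apply: fpos_ge0.
by apply: (fle_diff muV h); rewrite opprD addrA.
Qed.

(** For positive [x] and [y] this says that their infimum is [0]. *)
Definition fdisjoint (x y : E) := forall l, l <<= x -> l <<= y -> l <<= 0.

(** If [l] is below both parts, then [fpos x - l] still bounds [x] and [0] from above, so it
    dominates [fpos x]. *)
Lemma fdisjoint_pos_neg x : fdisjoint (fpos x) (fpos (- x)).
Proof.
move=> l lp ln; have: fpos x <<= fpos x - l.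
  apply: fpos_le; last exact/fle_sub0.
  rewrite [fpos x]fpos_fposN -addrA; apply: fle_addr => //.
  exact/fle_sub0.
by move=> h; apply: (fle_diff muV h); rewrite sub0r addrAC subrr add0r.
Qed.

(** A common lower bound [l] of [x + y] and [u] gives the common lower bound [l - y] of [x] and [u];
    hence [l <<= y], and disjointness of [y] and [u] applies. *)
Lemma fdisjointD x y u : 0 <<= y ->
  fdisjoint x u -> fdisjoint y u -> fdisjoint (x + y) u.
Proof.
move=> y0 dx dy l lxy lu; apply: (dy l) => //.
rewrite -[y]add0r; apply/fle_subLR => //; apply: dx; first exact/fle_subLR.
by apply: fle_trans lu => //; apply: fle_subr.
Qed.

(** The element [x + y - z] is below both [x] and [y], hence below [0]. *)
Lemma fdisjoint_leD x y z : x <<= z -> y <<= z -> fdisjoint x y -> x + y <<= z.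
Proof.
move=> xz yz d; have h : x + y - z <<= 0.
  apply: d; apply/fle_subLR => //; first by apply: fleD => //; apply: fle_refl.
  by rewrite addrC; apply: fleD => //; apply: fle_refl.
by move/fle_subLR : h; rewrite add0r; apply.
Qed.

(** The positive part of [l] also lies below every [e *: w]; were it nonzero, all its positive
    multiples would be bounded by [w]. *)
Lemma archimedean_le0 (l w : E) : fuzzy_archimedean mu -> 0 <<= w ->
  (forall e : R, 0 < e -> l <<= e *: w) -> l <<= 0.
Proof.
move=> arch w0 lw; have [p0|p0] := eqVneq (fpos l) 0.
  by rewrite -p0; apply: fle_fpos.
case: (arch _ (fpos_ge0 l) p0); exists w => c c0.
have : fpos l <<= c^-1 *: w.
  apply: fpos_le; first by apply: lw; rewrite invr_gt0.
  by apply: fle_scale0 => //; rewrite invr_ge0 ltW.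
by move/(fle_scale muV (ltW c0)); rewrite scalerA divff ?gt_eqF// scale1r.
Qed.

End Riesz.

(** * The ideal attached to a positive operator and a solid additive set [D] *)

Section ResidualIdeal.
Variables (R : realType) (E F : lmodType R) (mu : E -> E -> R) (nu : F -> F -> R).
Hypotheses (muR : fuzzy_riesz mu) (nuR : fuzzy_riesz nu).
Hypothesis arch : fuzzy_archimedean nu.
Variable T : {linear E -> F}.
Hypothesis Tpos : fuzzy_positive_op mu nu T.
Let muV : fuzzy_ordered_linear_space mu := proj1 muR.
Let nuV : fuzzy_ordered_linear_space nu := proj1 nuR.
Local Notation "x <<= y" := (fle mu x y) (at level 70).

Lemma fpositive_op_mono x y : x <<= y -> fle nu (T x) (T y).
Proof.
by move=> /(fle_sub0 muV) /Tpos h; apply/(fle_sub0 nuV); rewrite -linearB.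
Qed.

Variable D : E -> Prop.
Hypothesis D0 : D 0.
Hypothesis DD : forall a b, 0 <<= a -> 0 <<= b -> D a -> D b -> D (a + b).
Hypothesis D_solid : forall a b, 0 <<= a -> a <<= b -> D b -> D a.

Definition residual_bound (x : E) (l : F) : Prop :=
  forall a, D a -> 0 <<= a -> a <<= x -> fle nu l (T (x - a)).

(** [residual_null x] says that [inf {T (x - a) | a in D, 0 <= a <= x} = 0]
    without requiring infima to exist in [F]. *)
Definition residual_null (x : E) : Prop :=
  forall l, residual_bound x l -> fle nu l 0.

Definition residual_ideal (x : E) : Prop := residual_null (fabs mu x).

(** Given [a] in [D] below [y], the element [x - fpos (x - a)], which is the meet of [x] and [a],
    lies in [D] by solidity, and its residue [fpos (x - a)] is at most [y - a + e]. The case [e = 0]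
    gives monotonicity, small [e] gives closedness. *)
Lemma residual_bound_le x y e l : 0 <<= x -> 0 <<= e -> x <<= y + e ->
  residual_bound x l -> residual_bound y (l - T e).
Proof.
move=> x0 e0 xy lx a Da a0 ay; apply/(fle_subLR nuV); rewrite -linearD.
have ax' : x - fpos mu (x - a) <<= a.
  have /(fle_diff muV) := fle_fpos muR (x - a); apply.
  by rewrite !opprB addrCA.
have a'0 : 0 <<= x - fpos mu (x - a).
  by apply/(fle_sub0 muV); apply: fpos_le => //; apply: fle_subr.
apply: (@fle_trans _ _ _ nuV (T (x - (x - fpos mu (x - a))))).
  apply: lx => //; first exact: (D_solid a'0 ax').
  exact/fle_subr/fpos_ge0.
apply: fpositive_op_mono; rewrite opprB addrCA subrr addr0.
apply: fpos_le => //.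
  by rewrite addrAC; apply: fle_add2r.
rewrite -[0]addr0; apply: fleD => //; exact/fle_sub0.
Qed.

Lemma residual_null_le x y : 0 <<= x -> x <<= y ->
  residual_null y -> residual_null x.
Proof.
move=> x0 xy yn l lx; have := @residual_bound_le x y 0 l x0 (fle_refl muV 0).
by rewrite addr0 linear0 subr0 => /(_ xy lx) /yn.
Qed.

Lemma residual_nullD x y : 0 <<= x -> 0 <<= y ->
  residual_null x -> residual_null y -> residual_null (x + y).
Proof.
(* The two infima are taken one after the other: [a] is fixed first, then [b] varies, and [a + b] is
   admissible for [x + y]. *)
move=> x0 y0 xn yn l lxy; apply: xn => a Da a0 ax.
rewrite -[T _]add0r; apply/(fle_subLR nuV); apply: yn => b Db b0 bY.
apply/(fle_subLR nuV); rewrite addrC -linearD addrACA -opprD.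
apply: lxy; [exact: DD| |exact: fleD].
by rewrite -[0]addr0; apply: fleD.
Qed.

Lemma residual_nullMn x n : 0 <<= x -> residual_null x -> residual_null (x *+ n).
Proof.
move=> x0 xn; have xn0 m : 0 <<= x *+ m.
  by rewrite -scaler_nat; apply: fle_scale0.
elim: n => [|n IH]; last by rewrite mulrS; apply: residual_nullD.
by move=> l /(_ 0 D0 (fle_refl muV 0) (fle_refl muV 0)); rewrite subr0 linear0.
Qed.

Lemma residual_ideal_sub x : 0 <<= x -> D x -> residual_ideal x.
Proof.
move=> x0 Dx l; rewrite fabs_id // => /(_ x Dx x0 (fle_refl muV x)).
by rewrite subrr linear0.
Qed.

Lemma residual_ideal_fuzzy_ideal : fuzzy_ideal mu residual_ideal.
Proof.
split; last first.
  move=> x y a b /(fabsE muR) -> /(fabsE muR) ->.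
  exact/residual_null_le/fabs_ge0.
split; [|split] => [|x y Jx Jy|c x Jx].
- by apply: residual_ideal_sub => //; apply: fle_refl.
- apply: (residual_null_le (fabs_ge0 muR _) (fabsD_le muR x y)).
  by apply: residual_nullD => //; apply: fabs_ge0.
(* Bounding [|c|] by a natural number reduces scaling to repeated addition. *)
- have cx := fabsZ_le muR c x.
  apply: (residual_null_le (fabs_ge0 muR _) (fle_trans muV cx _)).
    apply: (fle_scaleW muV _ (fabs_ge0 muR x)).
    exact: ltW (archi_boundP (normr_ge0 c)).
  by rewrite scaler_nat; apply: residual_nullMn => //; apply: fabs_ge0.
Qed.

(** Since [|l| <<= |x n| + e *: w], a residual bound [z] of [|l|] yields the residual bound
    [z - T (e *: w)] of [|x n|]. Thus [z] is below [e *: T w] for every [e > 0]. *)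
Lemma residual_ideal_closed : uniformly_fuzzy_closed mu residual_ideal.
Proof.
move=> x l Jx [w [w0 xl]] z zl; apply: (archimedean_le0 nuR arch (Tpos w0)).
move=> e e0; rewrite -[e *: _]add0r -linearZ; apply/(fle_subLR nuV).
have [N /(_ N.+1 (ltnSn N))[_ [/(fabsE muR) -> lw]]] := xl e e0.
apply: (Jx N.+1); apply: residual_bound_le zl; first exact: fabs_ge0.
  by apply: fle_scale0 => //; apply: ltW.
rewrite -[l in fabs mu l](subrK (x N.+1)) addrC.
apply: (fle_trans muV (fabsD_le muR _ _)).
by apply: fleD => //; apply: fle_refl.
Qed.

End ResidualIdeal.

(** * Positive operators are order continuous when closed ideals are sigma-ideals *)

Section SigmaContinuity.
Variables (R : realType) (E F : lmodType R) (mu : E -> E -> R) (nu : F -> F -> R).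
Hypotheses (muR : fuzzy_riesz mu) (nuR : fuzzy_riesz nu).
Hypothesis arch : fuzzy_archimedean nu.
Variable T : {linear E -> F}.
Hypothesis Tpos : fuzzy_positive_op mu nu T.
Hypothesis closed_sigma : forall A : E -> Prop, fuzzy_ideal mu A ->
  uniformly_fuzzy_closed mu A -> fuzzy_sigma_ideal mu A.
Let muV : fuzzy_ordered_linear_space mu := proj1 muR.
Let nuV : fuzzy_ordered_linear_space nu := proj1 nuR.
Local Notation "x <<= y" := (fle mu x y) (at level 70).

Lemma decr_to_0_image (y : nat -> E) :
  decr_to_0 mu y -> decr_to_0 nu (fun n => T (y n)).
Proof.
move=> /decr_to_0P[dy y0 glb]; have Tm := fpositive_op_mono muR nuR Tpos.
apply/decr_to_0P; split=> [n|n|z zy]; [exact/Tm|exact: Tpos|].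
apply: (archimedean_le0 nuR arch (Tpos (y0 0%N))) => e e0.
pose v n := fpos mu (y n - e *: y 0%N).
(* As [v] decreases, disjointness from [v n] persists for larger indices; this makes [D] closed
   under sums of positive elements. *)
pose D a := exists n, fdisjoint mu a (v n).
have vdecr m n : (m <= n)%N -> v n <<= v m.
  by move=> /(decr_le muV dy) h; apply: fpos_mono => //; apply: fle_add2r.
have Dle m n a : (m <= n)%N -> fdisjoint mu a (v m) -> fdisjoint mu a (v n).
  by move=> /vdecr h d l la lv; apply: d => //; apply: fle_trans lv h.
have D0 : D 0 by exists 0%N.
have DD a b : 0 <<= a -> 0 <<= b -> D a -> D b -> D (a + b).
  move=> _ b0 [m am] [n bn]; exists (maxn m n).
  by apply: fdisjointD => //; [apply: Dle am|apply: Dle bn];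
    rewrite (leq_maxl, leq_maxr).
have D_solid a b : 0 <<= a -> a <<= b -> D b -> D a.
  by move=> _ ab [n bn]; exists n => l la; apply: bn; apply: fle_trans ab.
have JI := residual_ideal_fuzzy_ideal muR nuR Tpos D0 DD D_solid.
have JC := residual_ideal_closed muR nuR arch Tpos D_solid.
have [_ Jsigma] := closed_sigma JI JC.
have Jey : residual_ideal mu nu T D (e *: y 0%N).
  apply: (Jsigma (fun n => fpos mu (e *: y 0%N - y n))).
    move=> n; split; last exact: fpos_ge0.
    apply: residual_ideal_sub => //; first exact: fpos_ge0.
    by exists n; rewrite /v -[y n - _]opprB; apply: fdisjoint_pos_neg.
  split=> [n|].
    by apply: fpos_mono => //; rewrite ![e *: _ - _]addrC;
      apply: fle_add2r => //; apply: fle_opp.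
  split=> [_ [n ->]|u ub].
    apply: fpos_le => //; first exact: fle_subr.
    by apply: fle_scale0 => //; apply: ltW.
  (* An upper bound [u] satisfies [e *: y 0 - u <<= y n] for all [n], and the infimum of the [y n]
     is [0]. *)
  rewrite -[u]add0r; apply/fle_subLR => //; apply: glb => n.
  apply/fle_subLR => //; rewrite addrC; apply/fle_subLR => //.
  by apply: fle_trans (fle_fpos muR _) _ => //; apply: ub; exists n.
have /(_ e^-1) := JI.1.2.2 _ _ Jey.
rewrite scalerA mulVf ?gt_eqF// scale1r /residual_ideal fabs_id // => Jy.
rewrite -[_ *: _]add0r -linearZ; apply/(fle_subLR nuV).
apply: Jy => a [n an] a0 ay.
apply/(fle_subLR nuV); rewrite -linearD; apply: fle_trans (zy n) _ => //.
apply: Tm; apply/fle_subLR => //; apply: fle_trans (fle_fpos muR _) _ => //.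
rewrite -/(v n).
(* Both [a] and [v n] are below [y 0], so disjointness puts their sum below [y 0]. *)
have h : a + v n <<= y 0%N.
  apply: fdisjoint_leD => //; apply: fpos_le => //.
  apply: fle_trans (fle_subr muV _ _) _ => //.
    by apply: fle_scale0 => //; apply: ltW.
  exact: (decr_le muV dy).
by apply: (fle_diff muV h); rewrite opprD addrA.
Qed.

(** If [y] dominates [|x n|], then [T (y n)] dominates [|T (x n)|], because [|T x|] is at most
    [T |x|]. *)
Lemma fpositive_op_sigma_cont : fuzzy_sigma_order_cont mu nu T.
Proof.
move=> x [y [dy xy]]; exists (fun n => T (y n)); split.
  exact: decr_to_0_image.
move=> n; exists (fabs nu (T (x n) - 0)); split; first exact: fjoinP.
have [a []] := xy n; rewrite !subr0 => /(fabsE muR) -> xyn.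
have Tm := fpositive_op_mono muR nuR Tpos.
apply: fabs_le => //; rewrite -?linearN; apply: Tm; apply: fle_trans xyn => //.
  exact: fle_fabs.
exact: fleN_fabs.
Qed.

End SigmaContinuity.

(** * The quotient of a vector space by a subspace *)

Lemma exists_quotient_lmod (R : realType) (E : lmodType R) (A : E -> Prop) :
  subspace A -> exists (F : lmodType R) (p : {linear E -> F}),
    (forall q, exists x, p x = q) /\ (forall x, p x = 0 <-> A x).
Proof.
move=> [A0 [AD AZ]].
pose b : {pred E} := fun x => `[< A x >].
have bP x : x \in b <-> A x by split=> /asboolP.
have bB : zmod_closed b.
  split=> [|x y /bP Ax /bP Ay]; apply/bP => //.
  by rewrite -scaleN1r; apply: AD => //; apply: AZ.
pose bM := GRing.isZmodClosed.Build E b bB.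
pose I : zmodClosed E := HB.pack b bM.
pose Q := Quotient.quot I.
have piP (x y : E) : \pi_Q x = \pi_Q y <-> A (x - y).
  rewrite -bP -[b]/(I : {pred E}) Quotient.idealrBE.
  by split=> [->|/eqP].
(* Scalars act through representatives; [scE] shows independence of the choice, as [A] is stable
   under scaling. *)
pose sc (c : R) (q : Q) : Q := \pi_Q (c *: repr q).
have scE c x : sc c (\pi_Q x) = \pi_Q (c *: x).
  by apply/piP; rewrite -scalerBr; apply: AZ; apply/piP; rewrite reprK.
have piK (q : Q) : exists x, q = \pi_Q x by exists (repr q); rewrite reprK.
have scA c d q : sc c (sc d q) = sc (c * d) q.
  by have [x ->] := piK q; rewrite !scE scalerA.
have sc1 : left_id 1 sc by move=> q; have [x ->] := piK q; rewrite scE scale1r.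
have scDr : right_distributive sc +%R.
  move=> c q r; have [[x ->] [y ->]] := (piK q, piK r).
  by rewrite -raddfD !scE scalerDr raddfD.
have scDl q : {morph sc^~ q : c d / c + d}.
  by move=> c d; have [x ->] := piK q; rewrite !scE scalerDl raddfD.
pose QM := GRing.Zmodule_isLmodule.Build R Q scA sc1 scDr scDl.
pose F : lmodType R := HB.pack Q QM.
have piL : linear (\pi_Q : E -> F).
  by move=> c x y; rewrite raddfD; congr (_ + _); apply/esym/scE.
pose pM := GRing.isLinear.Build R E F _ _ piL.
pose p : {linear E -> F} := HB.pack (\pi_Q : E -> F) pM.
exists F, p; split=> [q|x]; first by exists (repr (q : Q)); apply: reprK.
by rewrite -[x in A x]subr0 -piP raddf0.
Qed.

(** * Ordinary vector lattices as fuzzy Riesz spaces with values in {0, 1} *)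

Section Crisp.
Variables (R : realType) (E : lmodType R) (le : E -> E -> Prop).

Definition crisp (x y : E) : R := (`[< le x y >])%:R.

Lemma fle_crisp x y : fle crisp x y <-> le x y.
Proof.
rewrite /fle /crisp; split=> [|xy].
  by case: asboolP => // _; rewrite ltNge invr_ge0 ler0n.
by rewrite asboolT // invf_lt1 // ltr1n.
Qed.

Lemma crisp_riesz :
  (forall x, le x x) -> (forall x y, le x y -> le y x -> x = y) ->
  (forall x y z, le x y -> le y z -> le x z) ->
  (forall x y z, le x y -> le (x + z) (y + z)) ->
  (forall x y (c : R), 0 < c -> le x y -> le (c *: x) (c *: y)) ->
  (forall x y, exists s, is_join crisp x y s) -> fuzzy_riesz crisp.
Proof.
move=> refl anti tr add scale join.
have crispV : fuzzy_ordered_linear_space crisp.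
  split; [split; [|split; [|split]]|split].
  - by move=> x y; rewrite ler0n lern1 leq_b1.
  - by move=> x; rewrite /crisp asboolT.
  - move=> x y; rewrite /crisp -natrD ltr1n.
    by do 2![case: asboolP => //] => yx xy _; apply: anti.
  - move=> x y z; rewrite /crisp.
    case: (asboolP (le x y)) => xy; last by rewrite ge_min ler0n.
    case: (asboolP (le y z)) => yz; last by rewrite ge_min ler0n orbT.
    by rewrite asboolT ?minxx //; apply: tr yz.
  - by move=> x y z /fle_crisp xy; rewrite /crisp !asboolT //; apply: add.
  - by move=> x y c /fle_crisp xy c0; rewrite /crisp !asboolT //; apply: scale.
split=> // x y; split; first exact: join.
(* Meets come from joins by negation. *)
have [s /is_joinP[xs ys lub]] := join (- x) (- y); exists (- s); split.
  by move=> z [->|->]; rewrite -[z in fle _ _ z]opprK; apply: fle_opp.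
move=> l ll; rewrite -[l]opprK; apply: fle_opp => //.
by apply: lub; apply: fle_opp => //; apply: ll; [left|right].
Qed.

End Crisp.

(** * The Riesz space structure on the quotient by a fuzzy ideal *)

Section QuotientOrder.
Variables (R : realType) (E F : lmodType R) (mu : E -> E -> R).
Variables (A : E -> Prop) (p : {linear E -> F}).
Hypothesis muR : fuzzy_riesz mu.
Hypothesis AI : fuzzy_ideal mu A.
Hypothesis p_surj : forall q, exists x, p x = q.
Hypothesis p_ker : forall x, p x = 0 <-> A x.
Let muV : fuzzy_ordered_linear_space mu := proj1 muR.
Local Notation "x <<= y" := (fle mu x y) (at level 70).

Let AD x y : A x -> A y -> A (x + y).
Proof. exact: AI.1.2.1. Qed.

Let AZ c x : A x -> A (c *: x).
Proof. exact: AI.1.2.2. Qed.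

Let AN x : A x -> A (- x).
Proof. by rewrite -scaleN1r; apply: AZ. Qed.

Let A_le x y : fabs mu x <<= y -> A y -> A x.
Proof.
move=> xy; apply: (AI.2 _ _ (fabs mu x) y _ _ xy); first exact: fjoinP.
by apply: is_abs_id => //; apply: fle_trans xy => //; apply: fabs_ge0.
Qed.

Let A_fabs x : A x -> A (fabs mu x).
Proof.
apply: (AI.2 _ _ (fabs mu x) (fabs mu x)); last exact: fle_refl.
  by apply: is_abs_id => //; apply: fabs_ge0.
exact: fjoinP.
Qed.

Let pE x y : p x = p y <-> A (x - y).
Proof.
rewrite -p_ker linearB; split=> [->|/eqP]; first by rewrite subrr.
by rewrite subr_eq0 => /eqP.
Qed.

Definition image_le (q r : F) : Prop :=
  exists x y, [/\ p x = q, p y = r & x <<= y].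

Definition image_order : F -> F -> R := crisp image_le.

Lemma image_orderP x y :
  fle image_order (p x) (p y) <-> exists2 a, A a & x <<= y + a.
Proof.
split=> [/fle_crisp[x' [y' [/pE xx' /pE yy' xy]]]|[a Aa xya]].
  (* This element of [A] absorbs the change of both lifts. *)
  exists (y' - y - (x' - x)); first by apply: AD => //; apply: AN.
  apply: (fle_diff muV xy).
  by rewrite opprB addrA (addrCA y) subrr addr0 -addrA (addrAC x) subrr add0r.
apply/fle_crisp; exists x, (y + a); split=> //.
by apply/pE; rewrite addrC addKr.
Qed.

(** With positive corrections [a] and [b], the sum [a + b] serves for two inequalities at once. *)
Lemma image_order_fabsP x y :
  fle image_order (p x) (p y) -> exists2 a, A a & 0 <<= a /\ x <<= y + a.
Proof.
move=> /image_orderP[a Aa xya]; exists (fabs mu a); first exact: A_fabs.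
split; first exact: fabs_ge0.
apply: fle_trans xya _ => //; apply: fleD => //; first exact: fle_refl.
exact: fle_fabs.
Qed.

Lemma image_order_mono x y : x <<= y -> fle image_order (p x) (p y).
Proof. by move=> xy; apply/fle_crisp; exists x, y. Qed.

Lemma image_order_join x y s :
  is_join mu x y s -> is_join image_order (p x) (p y) (p s).
Proof.
move=> /is_joinP[xs ys lub]; apply/is_joinP; split; [exact: image_order_mono..|].
move=> q; have [u <-] := p_surj q.
move=> /image_order_fabsP[a Aa [a0 xa]] /image_order_fabsP[b Ab [b0 yb]].
apply/image_orderP; exists (a + b); first exact: AD.
apply: lub; rewrite addrA; first by apply: fle_trans xa _ => //; apply: fle_addr.
rewrite addrAC.
by apply: fle_trans yb _ => //; apply: fle_addr.
Qed.

Lemma image_order_riesz : fuzzy_riesz image_order.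
Proof.
apply: crisp_riesz.
- by move=> q; have [x <-] := p_surj q; exists x, x; split=> //; apply: fle_refl.
- move=> q r; have [[x <-] [y <-]] := (p_surj q, p_surj r).
  move=> /fle_crisp /image_order_fabsP[a Aa [a0 xa]].
  move=> /fle_crisp /image_order_fabsP[b Ab [b0 yb]].
  apply/pE; apply: (@A_le _ (a + b)); last exact: AD.
  apply: fabs_le => //; rewrite ?opprB; apply/fle_subLR => //.
    rewrite addrC addrA; apply: fle_trans xa _ => //; exact: fle_addr.
  rewrite addrC [a + b]addrC addrA; apply: fle_trans yb _ => //; exact: fle_addr.
- move=> q r s; have [[x <-] [y <-]] := (p_surj q, p_surj r).
  have [z <-] := p_surj s.
  move=> /fle_crisp /image_orderP[a Aa xa] /fle_crisp /image_orderP[b Ab yb].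
  apply/fle_crisp/image_orderP; exists (b + a); first exact: AD.
  by apply: fle_trans xa _ => //; rewrite addrA; apply: fle_add2r.
- move=> _ _ r [x [y [<- <- xy]]]; have [z <-] := p_surj r.
  by exists (x + z), (y + z); rewrite !linearD; split=> //; apply: fle_add2r.
- move=> _ _ c c0 [x [y [<- <- xy]]]; exists (c *: x), (c *: y).
  by rewrite !linearZ; split=> //; apply: fle_scale => //; apply: ltW.
- move=> q r; have [[x <-] [y <-]] := (p_surj q, p_surj r).
  by exists (p (fjoin mu x y)); apply/image_order_join/fjoinP.
Qed.

Lemma image_order_archimedean :
  uniformly_fuzzy_closed mu A -> fuzzy_archimedean image_order.
Proof.
move=> AC q /fle_crisp[x0 [x1 [px0 <- x01]]] q0 [u ub].
(* As [x0] lifts [0], the difference [x] is a positive lift of [q]. *)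
have [u0 pu0] := p_surj u; pose w := fabs mu u0; pose x := x1 - x0.
have x_ge0 : 0 <<= x by apply/fle_sub0.
have px : p x = p x1 by rewrite linearB px0 subr0.
have w0 : 0 <<= w by apply: fabs_ge0.
pose e n : R := n.+1%:R^-1.
have e0 n : 0 <= e n by rewrite invr_ge0 ler0n.
move/eqP: q0; apply; rewrite -px; apply/p_ker.
apply: (AC (fun n => fpos mu (x - e n *: w))) => [n|].
  have := ub n.+1%:R (ltr0Sn _ _); rewrite -px -linearZ -pu0.
  move=> /image_order_fabsP[a Aa [a0 xa]].
  (* Dividing [n.+1 *: x <<= u0 + a] by [n.+1] bounds [x - e n *: w] by [e n *: a]. *)
  apply: (@A_le _ (e n *: a)); last exact: AZ.
  rewrite fabs_id ?fpos_ge0 //; last exact: fpos_ge0.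
  apply: fpos_le => //; last exact: fle_scale0.
  apply/fle_subLR => //; rewrite addrC -scalerDr.
  have := fle_scale muV (e0 n) xa; rewrite scalerA mulVf ?pnatr_eq0// scale1r.
  move=> h; apply: fle_trans h _ => //; apply: fle_scale => //.
  by apply: fle_add2r => //; apply: fle_fabs.
(* The error lies between [0] and [e n *: w], and [e n <= eps] once [n] exceeds a natural bound of
   [eps^-1]. *)
exists w; split=> // eps eps0; exists (Num.bound eps^-1) => n Nn.
exists (x - fpos mu (x - e n *: w)); split.
  apply: is_abs_id => //; apply/fle_sub0 => //; apply: fpos_le => //.
  by apply: fle_subr => //; apply: fle_scale0.
apply: (fle_trans muV (y := e n *: w)).
  apply: (fle_diff muV (fle_fpos muR (x - e n *: w))).
  by rewrite !opprB addrCA.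
apply: fle_scaleW => //; rewrite -[eps]invrK lef_pV2 ?posrE ?invr_gt0 ?ltr0Sn//.
apply: le_trans (ltW (archi_boundP _)) _; first by rewrite invr_ge0 ltW.
by rewrite ler_nat; apply/leqW/ltnW.
Qed.

End QuotientOrder.

(** * Lattice homomorphisms, their kernels, and the equivalence *)

Lemma fuzzy_lattice_hom_positive (R : realType) (E F : lmodType R)
    (mu : E -> E -> R) (nu : F -> F -> R) (T : {linear E -> F}) :
  fuzzy_riesz mu -> fuzzy_lattice_hom mu nu T -> fuzzy_positive_op mu nu T.
Proof.
(* Positivity of [x] makes it the join of [0] and [x], a relation that [T] preserves. *)
move=> [muV _] hT x x0; have /hT/is_joinP[+ _ _] : is_join mu 0 x x.
  by apply/is_joinP; split=> //; apply: fle_refl.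
by rewrite linear0.
Qed.

(** The sequence [l - x n] decreases to [0], while its image is constantly [T l]; a constant
    sequence converging to [0] in order is [0]. *)
Lemma sigma_cont_kernel (R : realType) (E F : lmodType R)
    (mu : E -> E -> R) (nu : F -> F -> R) (T : {linear E -> F})
    (x : nat -> E) (l : E) :
  fuzzy_riesz mu -> fuzzy_riesz nu -> fuzzy_sigma_order_cont mu nu T ->
  (forall n, T (x n) = 0) -> incr_to mu x l -> T l = 0.
Proof.
move=> muR nuR Tc Tx [xinc [xub xlub]].
have [muV nuV] := (muR.1, nuR.1).
have xl n : fle mu (x n) l by apply: xub; exists n.
have [|y [/(decr_to_0P) [_ _ y0] yT]] := Tc (fun n => l - x n).
  exists (fun n => l - x n); split.
    apply/decr_to_0P; split=> [n|n|z zl]; last 1 first.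
    - have h : fle mu l (l - z).
        by apply: xlub => _ [n ->]; apply: (fle_diff muV (zl n)); rewrite addrAC.
      by apply: (fle_diff muV h); rewrite [RHS]addrAC subrr.
    - by rewrite ![l - _]addrC; apply: fle_add2r => //; apply: fle_opp.
    - exact/fle_sub0.
  move=> n; exists (l - x n); rewrite subr0; split; last exact: fle_refl.
  by apply: is_abs_id => //; apply/fle_sub0.
have Tl0 : fle nu (fabs nu (T l)) 0.
  apply: y0 => n; have [a []] := yT n; rewrite subr0 linearB Tx subr0.
  by move=> /(fabsE nuR) ->.
apply: (fle_anti nuV); first exact: fle_trans (fle_fabs nuR _) Tl0.
rewrite -[T l]opprK -oppr0; apply: fle_opp => //.
exact: fle_trans (fleN_fabs nuR _) Tl0.
Qed.

Theorem theorem4p8 (R : realType) (E : lmodType R) (mu : E -> E -> R) :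
  fuzzy_riesz mu ->
  [<-> sigma_order_continuity_property mu;
       (forall (F : lmodType R) (nu : F -> F -> R),
          fuzzy_riesz nu -> fuzzy_archimedean nu ->
          forall T : {linear E -> F}, fuzzy_lattice_hom mu nu T ->
            fuzzy_sigma_order_cont mu nu T);
       (forall A : E -> Prop, fuzzy_ideal mu A -> uniformly_fuzzy_closed mu A ->
          fuzzy_sigma_ideal mu A)].
Proof.
move=> muR; tfae.
- move=> prop F nu nuR arch T hT; apply: prop => //.
  exact: fuzzy_lattice_hom_positive hT.
- move=> homs A AI AC; split=> // x l Ax xl.
  have [F [p [p_surj p_ker]]] := exists_quotient_lmod AI.1.
  have nuR := image_order_riesz muR AI p_surj p_ker.
  apply/p_ker; apply: (sigma_cont_kernel muR nuR _ _ xl) => [|n].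
    apply: homs => //; first exact: image_order_archimedean AC.
    by move=> a b s; apply: (image_order_join muR AI).
  by apply/p_ker; have [] := Ax n.
- move=> closed_sigma F nu nuR arch T Tpos.
  exact: fpositive_op_sigma_cont.
Qed.
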